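(* Let $G$ be a locally compact group and let $K$ be a compact and open subset of $G$. Let $h=\chi_K$ be the characteristic function of $K$. Then $K$ is a subgroup of $G$ if and only if $h$ is a group-like projection, i.e. $h\neq 0$ and $\Delta(h)(1\otimes h)=h\otimes h$.
   Context: $C_0(G)$ is the C$^*$-algebra of continuous complex functions on $G$ tending to $0$ at infinity, and bounded continuous functions on $G\times G$ are viewed as multipliers of $C_0(G)\otimes C_0(G)=C_0(G\times G)$. The coproduct is $(\Delta(f))(p,q)=f(pq)$ for $f\in C_0(G)$, $p,q\in G$. A group-like projection is a non-zero element $h$ with $h^2=h=h^*$ and $\Delta(h)(1\otimes h)=h\otimes h$; here the last equation means $h(pq)h(q)=h(p)h(q)$ for all $p,q\in G$. Group-like projections are always assumed non-zero. *)

(* Defs.v *)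
From HB Require Import structures.
From mathcomp Require Import all_boot all_order all_algebra.
From mathcomp Require Export complex.
From mathcomp Require Import all_classical all_reals all_analysis.
Import GRing.Theory Num.Theory.
Import numFieldNormedType.Exports.

Set Implicit Arguments.
Unset Strict Implicit.
Unset Printing Implicit Defensive.

Local Open Scope classical_set_scope.
Local Open Scope ring_scope.
Local Open Scope complex_scope.

(* Multiplicatively written topological groups: the library only has the
   additive commutative [topologicalZmodType]. *)
HB.mixin Record isTopologicalGroup G & Topological G & Group G := {
  mulg_continuous : continuous (fun x : G * G => (x.1 * x.2)%g) ;
  invg_continuous : continuous (fun x : G => (x^-1)%g) ;
}.

#[short(type="topologicalGroupType")]
HB.structure Definition TopologicalGroup :=
  {G of Topological G & Group G & isTopologicalGroup G}.

(* The Hausdorff axiom is part of the standard definition. *)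
Definition locally_compact_group (G : topologicalGroupType) : Prop :=
  hausdorff_space G /\ locally_compact [set: G].

Definition vanishes_at_infinity (R : realType) (T : topologicalType)
    (f : T -> R[i]) : Prop :=
  forall e : R, 0 < e ->
    exists2 B : set T, compact B & forall x, ~ B x -> `|f x| < e%:C.

(* The underlying set of the C*-algebra C_0(T); [R[i]^o] is R[i] with the topology
   of the modulus. *)
Definition C0 (R : realType) (T : topologicalType) : set (T -> R[i]) :=
  [set f : T -> R[i] |
     continuous (f : T -> R[i]^o) /\ vanishes_at_infinity f].

Definition coproduct (R : realType) (G : groupType) (f : G -> R[i])
    : G * G -> R[i] :=
  fun x => f (x.1 * x.2)%g.

Definition tensor (R : realType) (S T : Type) (f : S -> R[i]) (g : T -> R[i])
    : S * T -> R[i] :=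
  fun x => f x.1 * g x.2.

Definition adjoint (R : realType) (T : Type) (f : T -> R[i]) : T -> R[i] :=
  fun x => (f x)^*.

(* Multipliers of C_0(G) (x) C_0(G) = C_0(G x G) are functions on G x G, with
   the pointwise product; the constant function 1 is the unit. *)
Definition group_like_projection (R : realType) (G : topologicalGroupType)
    (h : G -> R[i]) : Prop :=
  [/\ C0 h, h <> cst 0, h \* h = h, adjoint h = h &
      coproduct h \* tensor (cst 1) h = tensor h h].

(* Main.v *)
(* On points the identity Delta(h)(1 (x) h) = h (x) h says that, for q in K,
   pq lies in K iff p does. Taking p = 1, then replacing p by p q^-1, this makes
   a nonempty K contain 1 and be closed under division. Conversely, compactness
   in a Hausdorff group makes K clopen, so that h is continuous with compact
   support. *)
Require Import Defs.
From HB Require Import structures.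
From mathcomp Require Import all_boot all_order all_algebra.
From mathcomp Require Import all_classical all_reals all_analysis.

Import GRing.Theory Num.Theory.

Local Open Scope classical_set_scope.
Local Open Scope ring_scope.

(** The indicator is locally constant: [A] and its complement are both open, so every point has a
    neighbourhood on which it takes a single value. *)
Lemma continuous_indic_clopen (R : realType) (T : topologicalType) (A : set T) :
  clopen A -> continuous (\1_A : T -> R[i]^o).
Proof.
move=> [oA cA] x; apply: cvg_near_cst; have [Ax|nAx] := pselect (A x).
  apply: filterS (open_nbhs_nbhs (conj oA Ax)) => y Ay.
  by rewrite !indicE !mem_set.
apply: filterS (open_nbhs_nbhs (conj (closed_openC cA) nAx)) => y nAy.
by rewrite !indicE !memNset.
Qed.

Lemma vanishes_at_infinity_indic (R : realType) (T : topologicalType)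
    (A : set T) :
  compact A -> vanishes_at_infinity (\1_A : T -> R[i]).
Proof.
move=> cA e e0; exists A => // x nAx.
by rewrite indicE memNset// normr0 ltcR.
Qed.

Lemma indic_neq0 (R : realType) (T : Type) (A : set T) :
  (\1_A : T -> R[i]) <> cst 0 <-> A !=set0.
Proof.
split=> [nz|[x Ax] /(congr1 (@^~ x))].
  apply/set0P/eqP => A0; apply: nz.
  by apply/funext => x; rewrite A0 indic0.
by rewrite indicE mem_set//=; apply/eqP; rewrite oner_eq0.
Qed.

(** At [(p, q)] both sides carry the factor [h q], so they vanish for [q] outside [K]; for [q] in
    [K] what remains is [h (p * q) = h p]. *)
Lemma coproduct_indicP (R : realType) (G : groupType) (K : set G) :
  let h := \1_K : G -> R[i] in
  coproduct h \* tensor (cst 1) h = tensor h h <->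
  forall p q, K q -> K (p * q)%g <-> K p.
Proof.
move=> h; split=> [hh p q Kq|KK]; last first.
  apply/funext => -[p q]; rewrite /coproduct /tensor /h /= !indicE mul1r.
  have [/set_mem/(KK p) Kpq|_] := boolP (q \in K); last by rewrite !mulr0.
  congr (_%:R * _); congr nat_of_bool.
  by apply/idP/idP => /set_mem/Kpq/mem_set.
have := congr1 (@^~ (p, q)) hh.
rewrite /coproduct /tensor /h /= !indicE mul1r (mem_set Kq) !mulr1 => /eqP.
(* [R[i]] has characteristic zero, so equal 0/1 values come from equal booleans. *)
rewrite eqr_nat => Kpq_eq.
have Kpq : ((p * q)%g \in K) = (p \in K).
  by case: (_ \in K) (_ \in K) Kpq_eq => [] [].
by split=> /mem_set ?; apply: set_mem; rewrite ?Kpq// -Kpq.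
Qed.

Lemma group_closed_setP (G : groupType) (K : set G) :
  group_closed [in K] <->
  K !=set0 /\ forall p q, K q -> K (p * q)%g <-> K p.
Proof.
split=> [Kg|[[q Kq] KK]].
  have KM := group_closedM Kg; have KV := group_closedV Kg.
  split=> [|p q Kq]; first by exists 1%g; exact: set_mem Kg.1.
  split=> [Kpq|Kp]; apply: set_mem; last by apply: KM; exact: mem_set.
  (* Here [p] is [(p * q) / q], a quotient of two elements of [K]. *)
  by rewrite -[p](mulgK q); apply: Kg.2; exact: mem_set.
have K1 : K 1%g by apply/(KK _ _ Kq); rewrite mul1g.
split=> [|x y /set_mem Kx /set_mem Ky]; apply: mem_set => //.
by apply/(KK _ _ Ky); rewrite mulgVK.
Qed.

Theorem proposition1p4 (R : realType) (G : topologicalGroupType) (K : set G)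
    (hG : locally_compact_group G) (cK : compact K) (oK : open K) :
  group_closed [in K] <-> group_like_projection (\1_K : G -> R[i]).
Proof.
(* Both sides pass through the same pair of conditions: [h <> 0] matches [K0], and the coproduct
   identity matches [KK]. *)
split=> [/group_closed_setP[K0 KK]|[_ /indic_neq0 K0 _ _ /coproduct_indicP KK]].
  split; [|exact/indic_neq0| | |exact/coproduct_indicP].
  - split; last exact: vanishes_at_infinity_indic.
    apply: continuous_indic_clopen; split=> //.
    exact: compact_closed hG.1 cK.
  - by apply/funext => x; rewrite /= indicE -natrM mulnb andbb.
  (* The values are natural numbers, hence fixed by conjugation. *)
  - by apply/funext => x; rewrite /adjoint indicE rmorph_nat.
exact/group_closed_setP.
Qed.
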